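(* Let $a\ge0$, $\gamma_1,\gamma_2\in\mathbb{N}_0$ and $f\in C_{\gamma_1,\gamma_2}(I)$. Then for every $(x,y)\in I$, $$\lim_{n_1,n_2\to\infty}K_{n_1,n_2}^a(f;x,y)=f(x,y).$$
   Context: $I=[0,\infty)\times[0,\infty)$, $\mathbb{N}_0=\{0,1,2,\dots\}$; $a\ge0$ is a fixed real parameter; functions are real-valued; $n_1,n_2$ are positive integers. Operators: let $(n)_0=1$, $(n)_i=n(n+1)\cdots(n+i-1)$ for $i\ge1$, $P_k(n,a)=\sum_{i=0}^{k}\binom{k}{i}(n)_i a^{k-i}$, and $$W_{n,k}^a(x)=e^{-\frac{ax}{1+x}}\frac{P_k(n,a)}{k!}\frac{x^k}{(1+x)^{n+k}},\qquad x\ge0,$$ (with $x^0=1$). Put $W^a_{n_1,n_2,k_1,k_2}(x,y)=W^a_{n_1,k_1}(x)W^a_{n_2,k_2}(y)$ and $$K_{n_1,n_2}^a(f;x,y)=(n_1+1)(n_2+1)\sum_{k_1=0}^\infty\sum_{k_2=0}^\infty W^a_{n_1,n_2,k_1,k_2}(x,y)\int_{\frac{k_2}{n_2+1}}^{\frac{k_2+1}{n_2+1}}\int_{\frac{k_1}{n_1+1}}^{\frac{k_1+1}{n_1+1}}f(u,v)\,du\,dv .$$ Weights and spaces: $\omega_\gamma(x)=(1+x^\gamma)^{-1}$ for $\gamma\in\mathbb{N}_0$ (with $x^0=1$), $\omega_{\gamma_1,\gamma_2}(x,y)=\omega_{\gamma_1}(x)\omega_{\gamma_2}(y)$. $C_{\gamma_1,\gamma_2}(I)$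 is the set of $f\in C(I)$ such that $\omega_{\gamma_1,\gamma_2}f$ is bounded and uniformly continuous on $I$. *)

(* Defs.v *)
From Stdlib Require Import Reals Factorial.
From Coquelicot Require Import Coquelicot.

Open Scope R_scope.

(* Functions on I are represented by total functions on R * R; only their
   values on [quadrant] are constrained or used. *)
Definition quadrant (p : R * R) : Prop := 0 <= fst p /\ 0 <= snd p.

Fixpoint rising (n i : nat) : R :=
  match i with
  | O => 1
  | S j => rising n j * (INR n + INR j)
  end.

(* [Binomial.C] is qualified because Coquelicot's [C] is the complex plane. *)
Definition P (k n : nat) (a : R) : R :=
  sum_f_R0 (fun i => Binomial.C k i * rising n i * a ^ (k - i)) k.

Definition W (a : R) (n k : nat) (x : R) : R :=
  exp (- (a * x / (1 + x))) * (P k n a / INR (fact k))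
  * (x ^ k / (1 + x) ^ (n + k)).

Definition W2 (a : R) (n1 n2 k1 k2 : nat) (x y : R) : R :=
  W a n1 k1 x * W a n2 k2 y.

(* For f continuous on [quadrant] the inner and outer integrals exist, and for f
   of polynomial growth the double series converges absolutely, so the total
   operators [RInt] and [Series] take their usual values and the order of
   summation is immaterial. *)
Definition K (a : R) (n1 n2 : nat) (f : R * R -> R) (x y : R) : R :=
  (INR n1 + 1) * (INR n2 + 1) *
  Series (fun k1 => Series (fun k2 =>
    W2 a n1 n2 k1 k2 x y *
    RInt (fun v =>
      RInt (fun u => f (u, v))
           (INR k1 / (INR n1 + 1)) ((INR k1 + 1) / (INR n1 + 1)))
      (INR k2 / (INR n2 + 1)) ((INR k2 + 1) / (INR n2 + 1)))).

Definition omega (g : nat) (x : R) : R := / (1 + x ^ g).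

Definition omega2 (g1 g2 : nat) (p : R * R) : R :=
  omega g1 (fst p) * omega g2 (snd p).

Definition continuous_on_quadrant (f : R * R -> R) : Prop :=
  forall p, quadrant p ->
    filterlim f (within quadrant (locally p)) (locally (f p)).

Definition bounded_on_quadrant (f : R * R -> R) : Prop :=
  exists M : R, forall p, quadrant p -> Rabs (f p) <= M.

(* [ball] on R * R is the sup-metric ball, which gives the same uniform
   structure as the Euclidean metric. *)
Definition unif_continuous_on_quadrant (f : R * R -> R) : Prop :=
  forall eps : posreal, exists delta : posreal,
    forall p q, quadrant p -> quadrant q ->
      ball p delta q -> ball (f p) eps (f q).

Definition C_weighted (g1 g2 : nat) (f : R * R -> R) : Prop :=
  continuous_on_quadrant f /\
  bounded_on_quadrant (fun p => omega2 g1 g2 p * f p) /\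
  unif_continuous_on_quadrant (fun p => omega2 g1 g2 p * f p).

(* Main.v *)
Require Import Defs.
From Stdlib Require Import Reals Factorial Lra Lia.
From Coquelicot Require Import Coquelicot.

Open Scope R_scope.

(** The proof is Korovkin's method with exponentials as test functions.

    The weights [W a n k x], [k = 0, 1, ...], are the probabilities of a sum of a
    Poisson and a negative binomial variable, and their generating function is
    explicit ([W_generating]):
      [sum_k W a n k x * z ^ k = exp (a x / (1 + x) * (z - 1)) / (1 - x (z - 1)) ^ n].
    At [z = 1] it shows that the weights have total mass 1. At
    [z = exp (s / (n + 1))] it tends to [exp (s x)] ([pgf_limit]), so the mean of
    [exp (s k / (n + 1))] converges to the value of [exp (s u)] at [u = x]. Taking
    [s = 1] and [s = -1], the mean of [cosh (k / (n + 1) - x)] tends to 1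
    ([cosh_moment_limit]).

    The function [cosh (u - x)] is a good test function for weighted spaces: it is
    at least [1 + (u - x) ^ 2 / 4], so it detects the distance from [x], and it
    grows faster than every power of [u]. Consequently, for each [eps > 0] there is
    [C] with
      [|f (u, v) - f (x, y)| <= eps + C * (cosh (u - x) * cosh (v - y) - 1)]
    on the whole quadrant ([deviation_le_cosh]). Averaging this over a mesh cell
    costs at most a factor [exp (1 / (n + 1))] for each [cosh]. Summing against the
    product weights gives
      [|K a n1 n2 f x y - f (x, y)| <= eps + C * (S1 * S2 - 1)]
    ([K_deviation]), where [S1] and [S2] tend to 1 as [n1] and [n2] tend to
    infinity, independently of each other. *)

(** * The generating function of the weights *)

Lemma rising_nonneg (n i : nat) : 0 <= rising n i.
Proof.
  induction i as [|i IH]; simpl; [lra|].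
  apply Rmult_le_pos; [exact IH|].
  pose proof (pos_INR n); pose proof (pos_INR i); lra.
Qed.

(** The recursion of [rising] runs on the right end of the product; peeling off
    the first factor instead turns the parameter [n] into [S n]. *)
Lemma rising_S_left (n i : nat) :
  rising n (S i) = INR n * rising (S n) i.
Proof.
  induction i as [|i IH]; [simpl; ring|].
  change (rising n (S (S i))) with (rising n (S i) * (INR n + INR (S i))).
  change (rising (S n) (S i)) with (rising (S n) i * (INR (S n) + INR i)).
  rewrite IH, !S_INR. ring.
Qed.

(** Multiplying a power series by the geometric series replaces its coefficients
    by their partial sums, so this identity is what carries the negative binomial
    series from exponent [n] to exponent [S n]. *)
Lemma rising_hockey_stick (n i : nat) :
  rising (S n) i / INR (fact i)
  = sum_f_R0 (fun j => rising n j / INR (fact j)) i.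
Proof.
  induction i as [|i IH]; [simpl; field|].
  rewrite tech5, <- IH, (rising_S_left n).
  change (rising (S n) (S i)) with (rising (S n) i * (INR (S n) + INR i)).
  rewrite fact_simpl, mult_INR, !S_INR.
  pose proof (INR_fact_neq_0 i); pose proof (pos_INR i).
  field. lra.
Qed.

(** Induction on [n]: one more factor [/ (1 - t)] is one more Cauchy product with
    the geometric series. *)
Lemma negative_binomial_series (n : nat) (t : R) :
  0 <= t < 1 ->
  is_series (fun i => rising n i / INR (fact i) * t ^ i) (/ (1 - t) ^ n).
Proof.
  intros Ht. induction n as [|n IH].
  - (* Only the term of index 0 survives, since [rising 0 (S k) = 0]; the zero
       tail is written as [0 ^ k * 0] so that it is a scaled geometric series. *)
    apply is_series_decr_1.
    apply (is_series_ext (fun _ => 0)).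
    { intros k. rewrite rising_S_left. simpl INR. unfold Rdiv.
      change (0 = 0 * rising 1 k * / INR (fact (S k)) * t ^ S k). ring. }
    replace (plus _ _) with (/ (1 - 0) * 0).
    2:{ change (/ (1 - 0) * 0 = / 1 + - (1 / 1 * 1) :> R). field. }
    apply (is_series_ext (fun k => 0 ^ k * 0)); [intros k; apply Rmult_0_r|].
    apply is_series_scal_r, is_series_geom.
    rewrite Rabs_R0; lra.
  - replace (/ (1 - t) ^ S n) with (/ (1 - t) ^ n * / (1 - t)).
    2:{ simpl. field. split; [apply pow_nonzero|]; lra. }
    eapply is_series_ext; [|apply is_series_mult_pos; [exact IH| apply is_series_geom | |]].
    + intros i. rewrite rising_hockey_stick, Rmult_comm, scal_sum.
      apply sum_eq. intros j Hj.
      replace (t ^ i) with (t ^ j * t ^ (i - j)); [ring|].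
      rewrite <- pow_add. f_equal. lia.
    + rewrite Rabs_pos_eq; lra.
    + intros i. pose proof (rising_nonneg n i). pose proof (INR_fact_lt_0 i).
      apply Rmult_le_pos; [apply Rdiv_le_0_compat; assumption|apply pow_le; lra].
    + intros i. apply pow_le; lra.
Qed.

(** [P k n a / k!] is the [k]-th coefficient of the Cauchy product of
    [(1 - t)^-n] and [exp (a t)]. *)
Lemma P_exponential_generating (a : R) (n : nat) (t : R) :
  0 <= a -> 0 <= t < 1 ->
  is_series (fun k => P k n a / INR (fact k) * t ^ k)
            (exp (a * t) / (1 - t) ^ n).
Proof.
  intros Ha Ht. unfold Rdiv at 2. rewrite Rmult_comm.
  eapply is_series_ext;
    [|apply is_series_mult_pos;
      [apply (negative_binomial_series n t Ht)
      |apply (proj1 (is_pseries_R _ _ _) (is_exp_Reals (a * t)))| |]].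
  - intros k. unfold P, Rdiv.
    rewrite Rmult_assoc, (Rmult_comm (sum_f_R0 _ _)), scal_sum. apply sum_eq. intros i Hi.
    unfold Binomial.C.
    replace (t ^ k) with (t ^ i * t ^ (k - i))
      by (rewrite <- pow_add; f_equal; lia).
    rewrite Rpow_mult_distr.
    field. repeat split; apply INR_fact_neq_0.
  - intros i. pose proof (rising_nonneg n i). pose proof (INR_fact_lt_0 i).
    apply Rmult_le_pos; [apply Rdiv_le_0_compat; assumption|apply pow_le; lra].
  - intros i. pose proof (INR_fact_lt_0 i).
    apply Rmult_le_pos; [left; apply Rinv_0_lt_compat; assumption|].
    apply pow_le, Rmult_le_pos; lra.
Qed.

(** For [a] and [x] nonnegative, the numbers [W a n k x], [k = 0, 1, ...], form the
    law of the sum of a Poisson variable of mean [a x / (1 + x)] and an independent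
    negative binomial variable; this is the probability generating function of that
    sum. *)
Definition pgf (a : R) (n : nat) (x z : R) : R :=
  exp (a * x / (1 + x) * (z - 1)) / (1 - x * (z - 1)) ^ n.

(** With [t = x / (1 + x)], the condition [x (z - 1) < 1] says exactly that
    [t z < 1], the range where the negative binomial series converges, and
    [1 - x (z - 1) = (1 + x) (1 - t z)]. *)
Lemma W_generating (a : R) (n : nat) (x z : R) :
  0 <= a -> 0 <= x -> 0 <= z -> x * (z - 1) < 1 ->
  is_series (fun k => W a n k x * z ^ k) (pgf a n x z).
Proof.
  intros Ha Hx Hz Hxz.
  assert (Hx1 : 0 < 1 + x) by lra.
  assert (Ht : 0 <= x * z / (1 + x) < 1).
  { split; [apply Rdiv_le_0_compat; [apply Rmult_le_pos|]; assumption|].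
    apply (Rmult_lt_reg_r (1 + x)); [assumption|]. field_simplify; lra. }
  pose proof (P_exponential_generating a n _ Ha Ht) as HP.
  pose proof (is_series_scal_l (exp (- (a * x / (1 + x))) / (1 + x) ^ n) _ _ HP) as H.
  replace (pgf a n x z) with
    (exp (- (a * x / (1 + x))) / (1 + x) ^ n *
     (exp (a * (x * z / (1 + x))) / (1 - x * z / (1 + x)) ^ n)).
  - refine (is_series_ext _ _ _ _ H). intros k. unfold W, scal; simpl.
    unfold mult; simpl.
    replace ((x * z / (1 + x)) ^ k) with (x ^ k * z ^ k / (1 + x) ^ k)
      by (unfold Rdiv; rewrite !Rpow_mult_distr, pow_inv; ring).
    rewrite pow_add.
    field. repeat split; try apply pow_nonzero; try apply INR_fact_neq_0; lra.
  - unfold pgf.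
    replace (a * x / (1 + x) * (z - 1))
      with (- (a * x / (1 + x)) + a * (x * z / (1 + x))) by (field; lra).
    replace (1 - x * (z - 1)) with ((1 + x) * (1 - x * z / (1 + x)))
      by (field; lra).
    rewrite exp_plus, Rpow_mult_distr.
    field. split; apply pow_nonzero; lra.
Qed.

Lemma W_nonneg (a : R) (n k : nat) (x : R) :
  0 <= a -> 0 <= x -> 0 <= W a n k x.
Proof.
  intros Ha Hx. unfold W.
  apply Rmult_le_pos; [apply Rmult_le_pos|].
  - left; apply exp_pos.
  - apply Rdiv_le_0_compat; [|apply INR_fact_lt_0].
    apply cond_pos_sum. intros i.
    apply Rmult_le_pos; [apply Rmult_le_pos|].
    + unfold Binomial.C. apply Rdiv_le_0_compat; [left; apply INR_fact_lt_0|].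
      apply Rmult_lt_0_compat; apply INR_fact_lt_0.
    + apply rising_nonneg.
    + apply pow_le; assumption.
  - apply Rdiv_le_0_compat; [apply pow_le; assumption|].
    apply pow_lt; lra.
Qed.

Lemma W_sum (a : R) (n : nat) (x : R) :
  0 <= a -> 0 <= x -> is_series (fun k => W a n k x) 1.
Proof.
  intros Ha Hx.
  assert (H : is_series (fun k => W a n k x * 1 ^ k) (pgf a n x 1)).
  { apply W_generating; lra. }
  unfold pgf in H.
  rewrite !Rminus_diag, !Rmult_0_r, exp_0, Rminus_0_r, pow1, Rdiv_1_r in H.
  refine (is_series_ext _ _ _ _ H). intros k. now rewrite pow1, Rmult_1_r.
Qed.

(** * The exponential moments converge *)

Lemma is_lim_seq_inv_succ : is_lim_seq (fun n => / (INR n + 1)) 0.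
Proof.
  apply (is_lim_seq_ext (fun n => / INR (S n))).
  { intros n. now rewrite S_INR. }
  apply (is_lim_seq_incr_1 (fun n => / INR n)).
  replace (Finite 0) with (Rbar_inv p_infty) by reflexivity.
  apply is_lim_seq_inv; [apply is_lim_seq_INR|discriminate].
Qed.

(** The factor of the increment is [n], while the step is [1 / (n + 1)]; the
    discrepancy is one extra [phi (1 / (n + 1))], which tends to 0. *)
Lemma is_lim_seq_scaled_increment (phi : R -> R) (l : R) :
  phi 0 = 0 -> derivable_pt_lim phi 0 l ->
  is_lim_seq (fun n => INR n * phi (/ (INR n + 1))) l.
Proof.
  intros H0 Hphi.
  assert (Hq : is_lim_seq (fun n => (INR n + 1) * phi (/ (INR n + 1))) l).
  { apply is_lim_seq_spec. intros eps.
    destruct (Hphi eps (cond_pos eps)) as [delta Hd].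
    pose proof (proj2 (is_lim_seq_spec _ _) is_lim_seq_inv_succ delta) as Hh.
    refine (filter_imp _ _ _ Hh). intros n Hn.
    assert (Hpos : 0 < INR n + 1) by (pose proof (pos_INR n); lra).
    rewrite Rminus_0_r in Hn.
    specialize (Hd (/ (INR n + 1)) (Rinv_neq_0_compat _ (Rgt_not_eq _ _ Hpos)) Hn).
    rewrite Rplus_0_l, H0 in Hd.
    replace ((INR n + 1) * phi (/ (INR n + 1)) - l)
      with ((phi (/ (INR n + 1)) - 0) / / (INR n + 1) - l); [exact Hd|].
    field. lra. }
  assert (Hp : is_lim_seq
    (fun n => / (INR n + 1) * ((INR n + 1) * phi (/ (INR n + 1)))) (0 * l)).
  { apply is_lim_seq_mult'; [exact is_lim_seq_inv_succ|exact Hq]. }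
  replace l with (l - 0 * l) by ring.
  eapply is_lim_seq_ext; [|exact (is_lim_seq_minus' _ _ _ _ Hq Hp)].
  intros n. simpl. pose proof (pos_INR n). field. lra.
Qed.

Lemma is_lim_seq_exp_node (s : R) :
  is_lim_seq (fun n => exp (s * / (INR n + 1))) 1.
Proof.
  replace (Finite 1) with (Finite (exp 0)) by now rewrite exp_0.
  apply (is_lim_seq_continuous exp); [apply derivable_continuous, derivable_exp|].
  replace (Finite 0) with (Finite (s * 0)) by now rewrite Rmult_0_r.
  apply (is_lim_seq_scal_l _ s 0), is_lim_seq_inv_succ.
Qed.

Lemma eventually_pgf_domain (x s : R) :
  eventually (fun n => x * (exp (s * / (INR n + 1)) - 1) < 1).
Proof.
  assert (H : is_lim_seq (fun n => x * (exp (s * / (INR n + 1)) - 1)) (x * (1 - 1))).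
  { apply (is_lim_seq_scal_l _ x (1 - 1)).
    apply is_lim_seq_minus'; [apply is_lim_seq_exp_node|apply is_lim_seq_const]. }
  refine (filter_imp _ _ _ (proj2 (is_lim_seq_spec _ _) H (mkposreal 1 Rlt_0_1))).
  intros n Hn; simpl in Hn. apply Rabs_def2 in Hn. lra.
Qed.

(** The [n]-th power in the denominator is [exp (n * phi (1 / (n + 1)))] with
    [phi h = ln (1 - x (exp (s h) - 1))], so its limit is read off from
    [phi' 0 = - s x]. The Poisson factor tends to 1. *)
Lemma pgf_limit (a x s : R) :
  is_lim_seq (fun n => pgf a n x (exp (s * / (INR n + 1)))) (exp (s * x)).
Proof.
  set (phi h := ln (1 - x * (exp (s * h) - 1))).
  assert (Hphi : is_lim_seq (fun n => INR n * phi (/ (INR n + 1))) (- (s * x))).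
  { apply is_lim_seq_scaled_increment; unfold phi.
    - rewrite Rmult_0_r, exp_0, Rminus_diag, Rmult_0_r, Rminus_0_r. apply ln_1.
    - apply is_derive_Reals. auto_derive;
        rewrite Rmult_0_r, exp_0; [lra|field; lra]. }
  apply (is_lim_seq_ext_loc (fun n =>
    exp (a * x / (1 + x) * (exp (s * / (INR n + 1)) - 1)
         - INR n * phi (/ (INR n + 1))))).
  - refine (filter_imp _ _ _ (eventually_pgf_domain x s)). intros n Hn.
    set (z := exp (s * / (INR n + 1))) in *. unfold pgf, phi. fold z.
    unfold Rminus at 1. rewrite exp_plus, exp_Ropp, <- ln_pow by lra.
    rewrite exp_ln by (apply pow_lt; lra). reflexivity.
  - apply (is_lim_seq_continuous exp); [apply derivable_continuous, derivable_exp|].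
    replace (s * x) with (a * x / (1 + x) * (1 - 1) - - (s * x)) by ring.
    apply is_lim_seq_minus'; [|exact Hphi].
    apply (is_lim_seq_scal_l _ (a * x / (1 + x)) (1 - 1)).
    apply is_lim_seq_minus'; [apply is_lim_seq_exp_node|apply is_lim_seq_const].
Qed.

(** The mean of [cosh (k / (n + 1) - x)] against the weights [W a n k x], in
    closed form. *)
Definition cosh_moment (a x : R) (n : nat) : R :=
  (exp (- x) * pgf a n x (exp (/ (INR n + 1)))
   + exp x * pgf a n x (exp (- / (INR n + 1)))) / 2.

(** [cosh] is a combination of two exponentials, and [exp (s k / (n + 1))] is the
    [k]-th power of [exp (s / (n + 1))]; so two values of the generating function
    give the sum. *)
Lemma W_cosh_series (a x : R) (n : nat) :
  0 <= a -> 0 <= x -> x * (exp (/ (INR n + 1)) - 1) < 1 ->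
  is_series (fun k => W a n k x * cosh (INR k / (INR n + 1) - x))
            (cosh_moment a x n).
Proof.
  intros Ha Hx Hdom.
  set (h := / (INR n + 1)) in *.
  assert (Hh : 0 < h).
  { apply Rinv_0_lt_compat. pose proof (pos_INR n). lra. }
  assert (Hdom' : x * (exp (- h) - 1) < 1).
  { assert (exp (- h) < 1) by (rewrite <- exp_0; apply exp_increasing; lra).
    apply Rle_lt_trans with 0; [|lra].
    rewrite <- (Rmult_0_r x). apply Rmult_le_compat_l; lra. }
  assert (Hp := W_generating a n x (exp h) Ha Hx (Rlt_le _ _ (exp_pos _)) Hdom).
  assert (Hm := W_generating a n x (exp (- h)) Ha Hx (Rlt_le _ _ (exp_pos _)) Hdom').
  assert (H := is_series_plus _ _ _ _
    (is_series_scal_r (exp (- x) / 2) _ _ Hp) (is_series_scal_r (exp x / 2) _ _ Hm)).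
  replace (cosh_moment a x n) with
    (plus (pgf a n x (exp h) * (exp (- x) / 2)) (pgf a n x (exp (- h)) * (exp x / 2))).
  - refine (is_series_ext _ _ _ _ H). intros k. unfold cosh.
    rewrite <- !Rpower_pow by apply exp_pos. unfold Rpower. rewrite !ln_exp.
    replace (INR k / (INR n + 1) - x) with (INR k * h + - x)
      by (unfold h, Rdiv; ring).
    replace (- (INR k * h + - x)) with (INR k * - h + x) by ring.
    rewrite !exp_plus. unfold plus; simpl. field.
  - unfold cosh_moment, plus; simpl. fold h. field.
Qed.

Lemma cosh_moment_limit (a x : R) : is_lim_seq (cosh_moment a x) 1.
Proof.
  replace 1 with ((exp (- x) * exp (1 * x) + exp x * exp (-1 * x)) * / 2).
  2:{ rewrite <- !exp_plus.
      replace (- x + 1 * x) with 0 by ring. replace (x + -1 * x) with 0 by ring.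
      rewrite exp_0. field. }
  apply (is_lim_seq_scal_r _ (/ 2)
    (Finite (exp (- x) * exp (1 * x) + exp x * exp (-1 * x)))).
  apply is_lim_seq_plus'.
  - apply (is_lim_seq_scal_l _ (exp (- x)) (Finite (exp (1 * x)))).
    refine (is_lim_seq_ext _ _ _ _ (pgf_limit a x 1)).
    intros n. now rewrite Rmult_1_l.
  - apply (is_lim_seq_scal_l _ (exp x) (Finite (exp (-1 * x)))).
    refine (is_lim_seq_ext _ _ _ _ (pgf_limit a x (-1))).
    intros n. do 2 f_equal. ring.
Qed.

(** * Hyperbolic cosine as a test function *)

(** Add [exp z >= 1 + z + z ^ 2 / 2] and [exp (- z) >= 1 - z] for [z >= 0]; the
    case [z < 0] follows by parity. *)
Lemma cosh_quadratic_lower_bound (z : R) : 1 + z ^ 2 / 4 <= cosh z.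
Proof.
  assert (Hpos : forall w, 0 <= w -> 1 + w ^ 2 / 4 <= cosh w).
  { intros w Hw. pose proof (exp_ge_taylor w 2 Hw) as H2.
    pose proof (exp_ineq1_le (- w)). simpl in H2. unfold cosh. lra. }
  destruct (Rle_dec 0 z) as [Hz|Hz]; [auto|].
  replace (cosh z) with (cosh (- z))
    by (unfold cosh; rewrite Ropp_involutive; field).
  replace (z ^ 2) with ((- z) ^ 2) by ring. apply Hpos. lra.
Qed.

Lemma cosh_ge_1 (z : R) : 1 <= cosh z.
Proof.
  pose proof (cosh_quadratic_lower_bound z). pose proof (pow2_ge_0 z). lra.
Qed.

Lemma exp_le_compat (u v : R) : u <= v -> exp u <= exp v.
Proof.
  intros [H| ->]; [left; now apply exp_increasing|apply Rle_refl].
Qed.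

(** The value of [cosh (u - x)] on a whole mesh cell is controlled by its value at
    the left end of the cell, up to a factor that tends to 1 with the mesh. *)
Lemma cosh_shift (z r : R) : 0 <= r -> cosh (z + r) <= exp r * cosh z.
Proof.
  intros Hr. unfold cosh.
  replace (- (z + r)) with (- z + - r) by ring. rewrite !exp_plus.
  assert (exp (- r) <= exp r).
  { apply exp_le_compat. lra. }
  pose proof (Rmult_le_compat_l _ _ _ (Rlt_le _ _ (exp_pos (- z))) H).
  lra.
Qed.

(** Exponential growth beats every power: from [u / m <= exp (u / m)] with
    [m = g + 1] one gets [u ^ g <= m ^ g * exp (g u / m) <= m ^ g * exp u]. *)
Lemma weight_le_cosh (g : nat) (x : R) :
  exists C, 0 <= C /\ forall u, 0 <= u -> 1 + u ^ g <= C * cosh (u - x).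
Proof.
  set (m := INR g + 1).
  assert (Hm : 0 < m) by (unfold m; pose proof (pos_INR g); lra).
  assert (Hmg : 0 < m ^ g) by (apply pow_lt; exact Hm).
  pose proof (exp_pos x) as Hex.
  assert (Hpe : 0 < m ^ g * exp x) by (apply Rmult_lt_0_compat; assumption).
  exists (1 + 2 * (m ^ g * exp x)). split; [lra|].
  intros u Hu.
  assert (Hpow : u ^ g <= m ^ g * exp u).
  { apply Rle_trans with (m ^ g * exp (u / m) ^ g).
    - rewrite <- Rpow_mult_distr. apply pow_incr. split; [exact Hu|].
      pose proof (exp_ineq1_le (u / m)).
      replace u with (m * (u / m)) at 1 by (field; lra).
      apply Rmult_le_compat_l; lra.
    - apply Rmult_le_compat_l; [lra|].
      rewrite <- Rpower_pow by apply exp_pos. unfold Rpower. rewrite ln_exp.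
      apply exp_le_compat.
      replace u with (m * (u / m)) at 2 by (field; lra).
      apply Rmult_le_compat_r; [apply Rdiv_le_0_compat; assumption|].
      unfold m; lra. }
  assert (Hexp : exp u <= exp x * (2 * cosh (u - x))).
  { unfold cosh. replace u with (x + (u - x)) at 1 by ring. rewrite exp_plus.
    apply Rmult_le_compat_l; [lra|]. pose proof (exp_pos (- (u - x))). lra. }
  pose proof (cosh_ge_1 (u - x)).
  pose proof (Rmult_le_compat_l _ _ _ (Rlt_le _ _ Hmg) Hexp).
  lra.
Qed.

(** The Korovkin estimate. Close to [(x, y)] continuity gives the bound [eps].
    Elsewhere the product [h] of the two hyperbolic cosines is at least [1 + c] for
    some [c > 0], hence [h <= (1 + 1/c) (h - 1)], and [h] dominates the polynomial
    growth of [f]. *)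
Lemma deviation_le_cosh (g1 g2 : nat) (f : R * R -> R) (x y eps : R) :
  C_weighted g1 g2 f -> 0 <= x -> 0 <= y -> 0 < eps ->
  exists C, 0 <= C /\ forall u v, 0 <= u -> 0 <= v ->
    Rabs (f (u, v) - f (x, y)) <= eps + C * (cosh (u - x) * cosh (v - y) - 1).
Proof.
  intros (Hcont & (M & HM) & _) Hx Hy Heps.
  destruct (weight_le_cosh g1 x) as (C1 & HC1 & H1).
  destruct (weight_le_cosh g2 y) as (C2 & HC2 & H2).
  assert (Hxy : quadrant (x, y)) by (split; assumption).
  assert (HM0 : 0 <= M).
  { eapply Rle_trans; [apply Rabs_pos|exact (HM _ Hxy)]. }
  destruct (Hcont _ Hxy (fun z => ball (f (x, y)) (mkposreal eps Heps) z)
              (locally_ball _ _)) as [delta Hdelta].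
  set (c := delta ^ 2 / 4).
  assert (Hc : 0 < c).
  { unfold c. apply Rdiv_lt_0_compat; [|lra]. apply pow_lt, cond_pos. }
  set (B := M * (C1 * C2) + Rabs (f (x, y))).
  assert (HB : 0 <= B).
  { apply Rplus_le_le_0_compat; [|apply Rabs_pos].
    apply Rmult_le_pos; [exact HM0|apply Rmult_le_pos; assumption]. }
  assert (Hic : 0 < / c) by (apply Rinv_0_lt_compat; exact Hc).
  exists (B * (1 + / c)). split; [apply Rmult_le_pos; lra|].
  intros u v Hu Hv.
  pose proof (cosh_ge_1 (u - x)) as Hcu. pose proof (cosh_ge_1 (v - y)) as Hcv.
  set (h := cosh (u - x) * cosh (v - y)).
  assert (Hh1 : 1 <= h) by (unfold h; nra).
  destruct (Rlt_or_le h (1 + c)) as [Hnear|Hfar].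
  - (* Both factors of [h] are at least 1, so each of them is below [1 + c], and
       the quadratic lower bound confines [u - x] and [v - y]. *)
    assert (Hclose : forall z, 1 + z ^ 2 / 4 <= h -> Rabs z < delta).
    { intros z Hz. apply Rnot_le_lt. intros Hle.
      pose proof (cond_pos delta).
      assert (delta ^ 2 <= z ^ 2).
      { rewrite <- (pow2_abs z). apply pow_incr. lra. }
      unfold c in *. nra. }
    assert (Hball : ball (x, y) delta (u, v)).
    { split; apply Hclose.
      - pose proof (cosh_quadratic_lower_bound (u - x)).
        change (1 + (u - x) ^ 2 / 4 <= cosh (u - x) * cosh (v - y)). nra.
      - pose proof (cosh_quadratic_lower_bound (v - y)).
        change (1 + (v - y) ^ 2 / 4 <= cosh (u - x) * cosh (v - y)). nra. }
    specialize (Hdelta _ Hball (conj Hu Hv)).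
    change (Rabs (f (u, v) - f (x, y)) < eps) in Hdelta.
    assert (0 <= B * (1 + / c) * (h - 1)).
    { apply Rmult_le_pos; [apply Rmult_le_pos|]; lra. }
    lra.
  - assert (Hf : Rabs (f (u, v)) <= M * ((1 + u ^ g1) * (1 + v ^ g2))).
    { pose proof (HM (u, v) (conj Hu Hv)) as H. unfold omega2, omega in H.
      simpl in H.
      pose proof (pow_le _ g1 Hu). pose proof (pow_le _ g2 Hv).
      assert (Hp : 0 < (1 + u ^ g1) * (1 + v ^ g2)) by (apply Rmult_lt_0_compat; lra).
      rewrite Rabs_mult, <- Rinv_mult, Rabs_pos_eq in H
        by (left; now apply Rinv_0_lt_compat).
      apply (Rmult_le_compat_l _ _ _ (Rlt_le _ _ Hp)) in H.
      rewrite <- Rmult_assoc, Rinv_r, Rmult_1_l in H by lra. lra. }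
    assert (Hw : (1 + u ^ g1) * (1 + v ^ g2) <= C1 * C2 * h).
    { replace (C1 * C2 * h) with ((C1 * cosh (u - x)) * (C2 * cosh (v - y)))
        by (unfold h; ring).
      pose proof (pow_le _ g1 Hu). pose proof (pow_le _ g2 Hv).
      apply Rmult_le_compat; try lra; auto. }
    assert (HfB : Rabs (f (u, v) - f (x, y)) <= B * h).
    { eapply Rle_trans; [apply Rabs_triang|]. rewrite Rabs_Ropp. unfold B.
      pose proof (Rmult_le_compat_l _ _ _ HM0 Hw).
      pose proof (Rabs_pos (f (x, y))). nra. }
    assert (Hhc : h <= (1 + / c) * (h - 1)).
    { assert (/ c * c <= / c * (h - 1)) as H by (apply Rmult_le_compat_l; lra).
      rewrite Rinv_l in H by lra. lra. }
    pose proof (Rmult_le_compat_l _ _ _ HB Hhc).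
    lra.
Qed.

(** * Averages over mesh cells *)

(** Clamping both coordinates to [0, oo) makes [f] continuous on the whole plane,
    which removes the boundary cells as a special case. The coordinate [v] comes
    first because the inner integral runs over [u] with [v] as a parameter. *)
Definition quadrant_extension (f : R * R -> R) (v u : R) : R :=
  f (Rmax 0 u, Rmax 0 v).

Lemma Rmax_0_lipschitz (s t : R) : Rabs (Rmax 0 s - Rmax 0 t) <= Rabs (s - t).
Proof.
  unfold Rmax.
  destruct (Rle_dec 0 s), (Rle_dec 0 t); unfold Rabs;
    repeat destruct Rcase_abs; lra.
Qed.

Lemma quadrant_extension_continuous (f : R * R -> R) (v u : R) :
  continuous_on_quadrant f -> continuity_2d_pt (quadrant_extension f) v u.
Proof.
  intros Hf eps.
  set (p := (Rmax 0 u, Rmax 0 v)).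
  assert (Hp : quadrant p) by (split; apply Rmax_l).
  destruct (Hf p Hp (fun z => ball (f p) eps z) (locally_ball _ _)) as [delta Hd].
  exists delta. intros v' u' Hv Hu.
  apply (Hd (Rmax 0 u', Rmax 0 v')); [|split; apply Rmax_l].
  split.
  - exact (Rle_lt_trans _ _ _ (Rmax_0_lipschitz u' u) Hu).
  - exact (Rle_lt_trans _ _ _ (Rmax_0_lipschitz v' v) Hv).
Qed.

Lemma ex_RInt_section (f : R * R -> R) (v a b : R) :
  continuous_on_quadrant f -> ex_RInt (quadrant_extension f v) a b.
Proof.
  intros Hf.
  apply (ex_RInt_continuous (V := R_CompleteNormedModule)). intros u _.
  apply filterlim_locally. intros eps.
  destruct (quadrant_extension_continuous f v u Hf eps) as [delta Hd].
  exists delta. intros u' Hu'. apply Hd; [|exact Hu'].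
  rewrite Rminus_diag, Rabs_R0. apply cond_pos.
Qed.

(** Uniform continuity on the compact segment [[a, b]], applied near [v], bounds
    the change of the integrand by [eps / (b - a + 1)]; the [+ 1] covers the
    degenerate case [a = b]. *)
Lemma RInt_section_continuous (f : R * R -> R) (a b v : R) :
  continuous_on_quadrant f -> a <= b ->
  continuous (fun v => RInt (quadrant_extension f v) a b) v.
Proof.
  intros Hf Hab. apply filterlim_locally. intros eps.
  assert (He : 0 < eps / (b - a + 1)).
  { apply Rdiv_lt_0_compat; [apply cond_pos|lra]. }
  destruct (uniform_continuity_2d_1d' (quadrant_extension f) a b v
    (fun u _ => quadrant_extension_continuous f v u Hf) (mkposreal _ He)) as [delta Hd].
  exists delta. intros v' Hv'.
  change (Rabs (v' - v) < delta) in Hv'.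
  change (Rabs (minus (RInt (quadrant_extension f v') a b)
                      (RInt (quadrant_extension f v) a b)) < eps).
  pose proof (cond_pos delta) as Hdelta. apply Rabs_def2 in Hv'.
  rewrite <- RInt_minus by (apply ex_RInt_section; exact Hf).
  apply Rle_lt_trans with ((b - a) * (eps / (b - a + 1))).
  - apply abs_RInt_le_const; [exact Hab| |].
    + apply (ex_RInt_minus (V := R_NormedModule)); now apply ex_RInt_section.
    + intros u Hu. left.
      apply (Hd u v u v'); try lra.
      rewrite Rminus_diag, Rabs_R0. exact Hdelta.
  - pose proof (cond_pos eps).
    replace (eps : R) with ((b - a + 1) * (eps / (b - a + 1))) at 2 by (field; lra).
    apply Rmult_lt_compat_r; lra.
Qed.

Lemma RInt_deviation (g : R -> R) (a b l D : R) :
  a <= b -> ex_RInt g a b ->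
  (forall t, a <= t <= b -> Rabs (g t - l) <= D) ->
  Rabs (RInt g a b - l * (b - a)) <= D * (b - a).
Proof.
  intros Hab Hg HD.
  replace (l * (b - a)) with (RInt (fun _ => l) a b)
    by (rewrite RInt_const; apply Rmult_comm).
  change (Rabs (minus (RInt g a b) (RInt (fun _ => l) a b)) <= D * (b - a)).
  rewrite <- RInt_minus; [|exact Hg|apply ex_RInt_const].
  rewrite (Rmult_comm D). apply abs_RInt_le_const; [exact Hab| |exact HD].
  apply (ex_RInt_minus (V := R_NormedModule)); [exact Hg|apply ex_RInt_const].
Qed.

Lemma rectangle_integral_deviation (f : R * R -> R) (a b c d l D : R) :
  continuous_on_quadrant f -> 0 <= a <= b -> 0 <= c <= d ->
  (forall u v, a <= u <= b -> c <= v <= d -> Rabs (f (u, v) - l) <= D) ->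
  Rabs (RInt (fun v => RInt (fun u => f (u, v)) a b) c d
        - l * ((b - a) * (d - c))) <= D * ((b - a) * (d - c)).
Proof.
  intros Hf Hab Hcd HD.
  rewrite <- !Rmult_assoc.
  rewrite (RInt_ext _ (fun v => RInt (quadrant_extension f v) a b)).
  - apply RInt_deviation; [lra| |].
    + apply (ex_RInt_continuous (V := R_CompleteNormedModule)). intros v _.
      apply RInt_section_continuous; [exact Hf|lra].
    + intros v Hv. apply RInt_deviation; [lra|now apply ex_RInt_section|].
      intros u Hu. unfold quadrant_extension. rewrite !Rmax_right by lra. apply HD; assumption.
  - intros v. rewrite Rmin_left, Rmax_right by lra. intros Hv.
    apply RInt_ext. intros u. rewrite Rmin_left, Rmax_right by lra. intros Hu.
    unfold quadrant_extension. now rewrite !Rmax_right by lra.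
Qed.

(** * Means against discrete probability weights *)

(** A pointwise bound on [A - l] passes to the mean. The majorant [e + c * b] need
    not be bounded, so the absolute convergence of the mean of [A] comes from that
    of [b]. *)
Lemma weighted_mean_deviation (w b A : nat -> R) (S l e c : R) :
  (forall k, 0 <= w k) -> is_series w 1 -> is_series (fun k => w k * b k) S ->
  (forall k, Rabs (A k - l) <= e + c * b k) ->
  Rabs (Series (fun k => w k * A k) - l) <= e + c * S.
Proof.
  intros Hw H1 HS HA.
  assert (Hbound : is_series (fun k => w k * (e + c * b k)) (e + c * S)).
  { replace (e + c * S) with (plus (1 * e) (S * c))
      by (unfold plus; simpl; ring).
    eapply is_series_ext; [|exact (is_series_plus _ _ _ _
      (is_series_scal_r e _ _ H1) (is_series_scal_r c _ _ HS))].
    intros k. unfold plus; simpl. ring. }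
  assert (Hle : forall k, 0 <= Rabs (w k * (A k - l)) <= w k * (e + c * b k)).
  { intros k. split; [apply Rabs_pos|].
    rewrite Rabs_mult, (Rabs_pos_eq (w k)) by apply Hw.
    apply Rmult_le_compat_l; auto. }
  assert (Habs : ex_series (fun k => Rabs (w k * (A k - l)))).
  { eapply (ex_series_le (V := R_CompleteNormedModule));
      [|exists (e + c * S); exact Hbound].
    intros k. change (Rabs (Rabs (w k * (A k - l))) <= w k * (e + c * b k)).
    rewrite Rabs_Rabsolu. apply Hle. }
  replace (Series (fun k => w k * A k) - l)
    with (Series (fun k => w k * (A k - l))).
  - eapply Rle_trans; [apply Series_Rabs; exact Habs|].
    rewrite <- (is_series_unique _ _ Hbound).
    apply Series_le; [exact Hle|]. exists (e + c * S); exact Hbound.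
  - pose proof (Series_correct _ (ex_series_Rabs _ Habs)) as Hdev.
    apply Rplus_eq_reg_r with (1 * l).
    replace (Series (fun k => w k * A k) - l + 1 * l)
      with (Series (fun k => w k * A k)) by ring.
    symmetry. apply is_series_unique.
    eapply is_series_ext; [|exact (is_series_plus _ _ _ _ Hdev (is_series_scal_r l _ _ H1))].
    intros k. unfold plus; simpl. ring.
Qed.

(** Applied to the inner and then to the outer sum, the one-dimensional estimate
    works because the bound is affine in [b2 k2] for [k1] fixed, and the bound that
    it gives for the inner mean is affine in [b1 k1]. The product of the
    two moments appears because the weights factor. *)
Lemma double_weighted_mean_deviation
  (w1 w2 b1 b2 : nat -> R) (B : nat -> nat -> R) (S1 S2 l e c : R) :
  (forall k, 0 <= w1 k) -> (forall k, 0 <= w2 k) ->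
  is_series w1 1 -> is_series w2 1 ->
  is_series (fun k => w1 k * b1 k) S1 -> is_series (fun k => w2 k * b2 k) S2 ->
  (forall k1 k2, Rabs (B k1 k2 - l) <= e + c * (b1 k1 * b2 k2 - 1)) ->
  Rabs (Series (fun k1 => Series (fun k2 => w1 k1 * w2 k2 * B k1 k2)) - l)
  <= e + c * (S1 * S2 - 1).
Proof.
  intros Hw1 Hw2 H1 H2 HS1 HS2 HB.
  rewrite (Series_ext _ (fun k1 => w1 k1 * Series (fun k2 => w2 k2 * B k1 k2))).
  - replace (e + c * (S1 * S2 - 1)) with ((e - c) + (c * S2) * S1) by ring.
    apply (weighted_mean_deviation w1 b1); try assumption. intros k1.
    replace ((e - c) + c * S2 * b1 k1) with ((e - c) + (c * b1 k1) * S2) by ring.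
    apply (weighted_mean_deviation w2 b2); try assumption. intros k2.
    specialize (HB k1 k2). lra.
  - intros k1. rewrite <- Series_scal_l. apply Series_ext. intros k2. ring.
Qed.

(** * Convergence of the operators *)

Definition node_bound (n k : nat) (x : R) : R :=
  exp (/ (INR n + 1)) * cosh (INR k / (INR n + 1) - x).

Lemma cosh_le_node_bound (n k : nat) (x u : R) :
  INR k / (INR n + 1) <= u <= (INR k + 1) / (INR n + 1) ->
  cosh (u - x) <= node_bound n k x.
Proof.
  intros [Hl Hr]. unfold node_bound.
  replace ((INR k + 1) / (INR n + 1)) with (INR k / (INR n + 1) + / (INR n + 1))
    in Hr by (unfold Rdiv; ring).
  set (c := INR k / (INR n + 1)) in *.
  replace (u - x) with (c - x + (u - c)) by ring.
  eapply Rle_trans; [apply cosh_shift; lra|].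
  apply Rmult_le_compat_r; [pose proof (cosh_ge_1 (c - x)); lra|].
  apply exp_le_compat. lra.
Qed.

Definition node_moment (a x : R) (n : nat) : R :=
  exp (/ (INR n + 1)) * cosh_moment a x n.

Lemma W_node_bound_series (a x : R) (n : nat) :
  0 <= a -> 0 <= x -> x * (exp (/ (INR n + 1)) - 1) < 1 ->
  is_series (fun k => W a n k x * node_bound n k x) (node_moment a x n).
Proof.
  intros Ha Hx Hdom. unfold node_moment. rewrite Rmult_comm.
  eapply is_series_ext;
    [|apply is_series_scal_r; exact (W_cosh_series a x n Ha Hx Hdom)].
  intros k. unfold node_bound. simpl. ring.
Qed.

Lemma node_moment_limit (a x : R) : is_lim_seq (node_moment a x) 1.
Proof.
  replace (Finite 1) with (Finite (1 * 1)) by now rewrite Rmult_1_l.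
  apply is_lim_seq_mult'; [|apply cosh_moment_limit].
  refine (is_lim_seq_ext _ _ _ _ (is_lim_seq_exp_node 1)).
  intros n. now rewrite Rmult_1_l.
Qed.

(** [K] is a double mean of cell averages of [f]. On each cell the hypothesis on
    [f] and the bounds on [cosh] control the deviation of the average from
    [f (x, y)] by an affine function of the product of the node bounds, and means
    of such functions are known. *)
Lemma K_deviation (a : R) (f : R * R -> R) (x y e c : R) (n1 n2 : nat) :
  0 <= a -> 0 <= x -> 0 <= y -> 0 <= c -> continuous_on_quadrant f ->
  (forall u v, 0 <= u -> 0 <= v ->
    Rabs (f (u, v) - f (x, y)) <= e + c * (cosh (u - x) * cosh (v - y) - 1)) ->
  x * (exp (/ (INR n1 + 1)) - 1) < 1 -> y * (exp (/ (INR n2 + 1)) - 1) < 1 ->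
  Rabs (K a n1 n2 f x y - f (x, y))
  <= e + c * (node_moment a x n1 * node_moment a y n2 - 1).
Proof.
  intros Ha Hx Hy Hc Hf Hdev Hd1 Hd2.
  assert (HN1 : 0 < INR n1 + 1) by (pose proof (pos_INR n1); lra).
  assert (HN2 : 0 < INR n2 + 1) by (pose proof (pos_INR n2); lra).
  set (I k1 k2 := RInt (fun v =>
    RInt (fun u => f (u, v))
      (INR k1 / (INR n1 + 1)) ((INR k1 + 1) / (INR n1 + 1)))
      (INR k2 / (INR n2 + 1)) ((INR k2 + 1) / (INR n2 + 1))).
  replace (K a n1 n2 f x y) with (Series (fun k1 => Series (fun k2 =>
    W a n1 k1 x * W a n2 k2 y * ((INR n1 + 1) * (INR n2 + 1) * I k1 k2)))).
  2:{ unfold K. rewrite <- Series_scal_l. apply Series_ext. intros k1.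
      rewrite <- Series_scal_l. apply Series_ext. intros k2.
      unfold W2. fold (I k1 k2). ring. }
  apply (double_weighted_mean_deviation
    (fun k => W a n1 k x) (fun k => W a n2 k y)
    (fun k => node_bound n1 k x) (fun k => node_bound n2 k y)
    (fun k1 k2 => (INR n1 + 1) * (INR n2 + 1) * I k1 k2)
    _ _ _ _ _ (fun k => W_nonneg a n1 k x Ha Hx) (fun k => W_nonneg a n2 k y Ha Hy)
    (W_sum a n1 x Ha Hx) (W_sum a n2 y Ha Hy)
    (W_node_bound_series a x n1 Ha Hx Hd1) (W_node_bound_series a y n2 Ha Hy Hd2)).
  intros k1 k2.
  set (D := e + c * (node_bound n1 k1 x * node_bound n2 k2 y - 1)).
  assert (Hcell : forall n k, 0 < INR n + 1 ->
    0 <= INR k / (INR n + 1) <= (INR k + 1) / (INR n + 1)).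
  { intros n k Hn. pose proof (pos_INR k). split.
    - apply Rdiv_le_0_compat; assumption.
    - apply Rmult_le_compat_r; [left; apply Rinv_0_lt_compat; assumption|lra]. }
  pose proof (Hcell n1 k1 HN1) as Hcell1. pose proof (Hcell n2 k2 HN2) as Hcell2.
  assert (HI := rectangle_integral_deviation f _ _ _ _ (f (x, y)) D
                  Hf Hcell1 Hcell2).
  fold (I k1 k2) in HI.
  replace (((INR k1 + 1) / (INR n1 + 1) - INR k1 / (INR n1 + 1)) *
           ((INR k2 + 1) / (INR n2 + 1) - INR k2 / (INR n2 + 1)))
    with (/ ((INR n1 + 1) * (INR n2 + 1))) in HI by (field; lra).
  set (N := (INR n1 + 1) * (INR n2 + 1)) in *.
  assert (HN : 0 < N) by now apply Rmult_lt_0_compat.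
  replace (N * I k1 k2 - f (x, y)) with (N * (I k1 k2 - f (x, y) * / N))
    by (field; lra).
  rewrite Rabs_mult, (Rabs_pos_eq N) by lra.
  replace D with (N * (D * / N)) by (field; lra).
  apply Rmult_le_compat_l; [lra|]. apply HI.
  intros u v Hu Hv.
  eapply Rle_trans; [apply Hdev; lra|].
  apply Rplus_le_compat_l, Rmult_le_compat_l; [exact Hc|].
  apply Rplus_le_compat_r.
  apply Rmult_le_compat; try now apply cosh_le_node_bound.
  - pose proof (cosh_ge_1 (u - x)); lra.
  - pose proof (cosh_ge_1 (v - y)); lra.
Qed.

Theorem theorem4 (a : R) (ha : 0 <= a) (g1 g2 : nat) (f : R * R -> R)
  (hf : C_weighted g1 g2 f) (x y : R) (hx : 0 <= x) (hy : 0 <= y) :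
  filterlim (fun n : nat * nat => K a (fst n) (snd n) f x y)
    (filter_prod eventually eventually) (locally (f (x, y))).
Proof.
  apply filterlim_locally. intros eps.
  pose proof (cond_pos eps) as Heps.
  destruct (deviation_le_cosh g1 g2 f x y (eps / 2) hf hx hy ltac:(lra))
    as (c & Hc & Hdev).
  assert (Hlim : filterlim
    (fun n => node_moment a x (fst n) * node_moment a y (snd n))
    (filter_prod eventually eventually) (locally (1 * 1))).
  { refine (filterlim_comp_2 _ _ _ _ _ (filterlim_mult (K := R_AbsRing) 1 1)).
    - eapply filterlim_comp; [apply filterlim_fst|apply node_moment_limit].
    - eapply filterlim_comp; [apply filterlim_snd|apply node_moment_limit]. }
  (* [c] may vanish, hence the denominator [c + 1]. *)
  assert (Heta : 0 < eps / 2 / (c + 1)) by (apply Rdiv_lt_0_compat; lra).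
  pose proof (proj1 (filterlim_locally _ _) Hlim (mkposreal _ Heta)) as Hnear.
  assert (Hdom : forall z, eventually (fun n => z * (exp (/ (INR n + 1)) - 1) < 1)).
  { intros z. refine (filter_imp _ _ _ (eventually_pgf_domain z 1)).
    intros n. now rewrite Rmult_1_l. }
  assert (Hd : filter_prod eventually eventually (fun n =>
    x * (exp (/ (INR (fst n) + 1)) - 1) < 1 /\
    y * (exp (/ (INR (snd n) + 1)) - 1) < 1)).
  { exact (Filter_prod _ _ _ _ _ (Hdom x) (Hdom y) (fun _ _ => @conj _ _)). }
  refine (filter_imp _ _ _ (filter_and _ _ Hnear Hd)).
  intros [n1 n2] [Hn [Hd1 Hd2]]. simpl in Hd1, Hd2.
  change (Rabs (node_moment a x n1 * node_moment a y n2 - 1 * 1)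
          < eps / 2 / (c + 1)) in Hn.
  change (Rabs (K a n1 n2 f x y - f (x, y)) < eps).
  eapply Rle_lt_trans;
    [exact (K_deviation a f x y _ c n1 n2 ha hx hy Hc (proj1 hf) Hdev Hd1 Hd2)|].
  apply Rabs_def2 in Hn. rewrite Rmult_1_l in Hn. destruct Hn as [Hn _].
  set (s := node_moment a x n1 * node_moment a y n2 - 1) in *.
  assert (c * s <= c * (eps / 2 / (c + 1))) by (apply Rmult_le_compat_l; lra).
  replace (eps / 2 / (c + 1)) with (eps / 2 * / (c + 1)) in * by reflexivity.
  assert (c * (eps / 2 * / (c + 1)) < (c + 1) * (eps / 2 * / (c + 1)))
    by (apply Rmult_lt_compat_r; lra).
  replace ((c + 1) * (eps / 2 * / (c + 1))) with (eps / 2) in * by (field; lra).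
  lra.
Qed.
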